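(* There is a universal constant $c>0$ such that the following holds. Let $\ell\ge2$, let $\kappa\in\mathbb{N}_+^\ell$ with $\kappa_1+\cdots+\kappa_\ell=n$, and let $A\subseteq\mathcal{U}_\kappa$. Let $p>0$ and $\epsilon>0$, and assume $\kappa_i\ge pn$ for all $i\in[\ell]$ and $\epsilon\le\mathrm{vol}(A)\le1-\epsilon$. Then $$\mathcal{E}[1_A]\ \ge\ c\cdot\frac{\epsilon}{\ell\log(1/p)}\cdot\frac{\log(1/\mathcal{M}[1_A])}{n}.$$
   Context: The multislice is $\mathcal{U}_\kappa=\{u\in[\ell]^n : u \text{ has exactly } \kappa_i \text{ coordinates equal to } i,\ \forall i\in[\ell]\}$, with uniform distribution $\pi_\kappa$; $\mathrm{vol}(A)=|A|/|\mathcal{U}_\kappa|$ and $1_A$ is the $0/1$ indicator of $A$. $S_n$ acts by $(u^\sigma)_j=u_{\sigma(j)}$; $\mathrm{Trans}(n)$ is the set of all $\binom n2$ transpositions. For $f:\mathcal{U}_\kappa\to\mathbb{R}$: $\mathrm{Inf}_\tau[f]=\tfrac12\mathbf{E}_{u\sim\pi_\kappa}[(f(u)-f(u^\tau))^2]$; $\mathcal{E}[f]=\binom n2^{-1}\sum_{\tau\in\mathrm{Trans}(n)}\mathrm{Inf}_\tau[f]$; $\mathcal{M}[f]=\max_{\tau\in\mathrm{Trans}(n)}\mathrm{Inf}_\tau[f]$. *)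

(* Defs.v *)
From HB Require Import structures.
From mathcomp Require Import all_boot all_order all_algebra all_fingroup.
From mathcomp Require Import reals exp.

Set Implicit Arguments.
Unset Strict Implicit.
Unset Printing Implicit Defensive.

Import Order.TTheory GRing.Theory Num.Theory.

Local Open Scope ring_scope.

Section Multislice.

Variables (l n : nat) (kappa : 'I_l -> nat).

(* The alphabet [l] is 'I_l; a word u in [l]^n is a finite function on 'I_n. *)
Definition has_histogram (u : {ffun 'I_n -> 'I_l}) : bool :=
  [forall i : 'I_l, #|[set j : 'I_n | u j == i]| == kappa i].

Record multislice := Multislice {
  word :> {ffun 'I_n -> 'I_l};
  wordP : has_histogram word
}.

HB.instance Definition _ := [isSub for word].
HB.instance Definition _ := [Finite of multislice by <:].

Lemma has_histogram_perm (s : 'S_n) (u : multislice) :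
  has_histogram [ffun j => u (s j)].
Proof.
apply/forallP => i; have /forallP/(_ i)/eqP <- := wordP u.
apply/eqP; rewrite -[RHS](card_preimset _ (@perm_inj _ s)).
by apply: eq_card => j; rewrite !inE ffunE.
Qed.

Definition act (u : multislice) (s : 'S_n) : multislice :=
  Multislice (has_histogram_perm s u).

Definition transpositions : {set 'S_n} :=
  [set t | [exists x : 'I_n, exists y : 'I_n, (x != y) && (t == tperm x y)]].

Variable R : realType.
Implicit Types (f : multislice -> R) (A : {set multislice}).

Definition expectation f : R := (\sum_u f u) / #|{: multislice}|%:R.

Definition vol A : R := #|A|%:R / #|{: multislice}|%:R.

Definition indicator A : multislice -> R := fun u => (u \in A)%:R.

Definition influence (t : 'S_n) f : R :=
  2^-1 * expectation (fun u => (f u - f (act u t)) ^+ 2).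

Definition energy f : R :=
  'C(n, 2)%:R^-1 * \sum_(t in transpositions) influence t f.

(* Influences are nonnegative, so for n >= 2 (when there are transpositions)
   the default value 0 does not affect the maximum. *)
Definition max_influence f : R :=
  \big[Num.max/0]_(t in transpositions) influence t f.

End Multislice.

Arguments multislice {l} n kappa.
Arguments vol {l n kappa} R A.
Arguments indicator {l n kappa} R A u.

(* Main.v *)
Require Import Defs.
From mathcomp Require Import all_boot all_order all_algebra all_fingroup.
From mathcomp Require Import reals exp.
From mathcomp Require Import ring lra.

Set Implicit Arguments.
Unset Strict Implicit.
Unset Printing Implicit Defensive.

Import Order.TTheory GRing.Theory Num.Theory.
Local Open Scope ring_scope.

(** Write L = I - avg_t t for the normalised Laplacian of the transposition walk
    and psi(f) = <f, L f>.

    Log-Sobolev inequality: Ent(g^2) <= K psi(g) with K of order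
    n l log(1/p), by induction on the set of free coordinates.  The entropy is
    split along the letter at a coordinate j and averaged over j; the one-site
    entropy is bounded by a variance, which swapping j with another coordinate
    turns into energy.  The constant is a potential in the histogram that does
    not increase on average when a uniformly random coordinate is exposed.

    From log-Sobolev to influences: let f be an indicator, f_k = (I - L/2)^k f,
    and apply the log-Sobolev inequality to the differences f_k - f_k^t.  Since
    L commutes with each transposition t, their L1 and squared L2 norms are at
    most 2 Inf_t[f], and x^2 log x^2 >= 2 x^2 - 2 |x| bounds their entropy from
    below.  Averaging over t,
      2 log(1/M) psi(f_k) <= 4 K (psi(f_k) - psi(f_(k+1))) + 4 psi(f),
    which telescopes over about K steps, while Var f <= 2 sum_k psi(f_k) by the
    Poincare inequality.  This discrete walk replaces hypercontractivity. *)

(** * Elementary inequalities for logarithms and finite sums *)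

Section Generalities.
Variable R : realType.

Lemma ln_le_sub1 (x : R) : 0 < x -> ln x <= x - 1.
Proof.
by move=> x0; have := expR_ge1Dx (ln x); rewrite lnK ?posrE// => ?; lra.
Qed.

Lemma ln_inv_ge (x : R) : 0 < x -> 1 - x^-1 <= ln x.
Proof.
move=> x0; have : ln x^-1 <= x^-1 - 1 by apply: ln_le_sub1; rewrite invr_gt0.
by rewrite lnV ?posrE// => ?; lra.
Qed.

Lemma sum_sqr_le (T : finType) (a : T -> R) :
  (\sum_t a t) ^+ 2 <= #|T|%:R * \sum_t a t ^+ 2.
Proof.
have : 0 <= \sum_t \sum_r (a t - a r) ^+ 2.
  by apply: sumr_ge0 => t _; apply: sumr_ge0 => r _; exact: sqr_ge0.
suff -> : \sum_t \sum_r (a t - a r) ^+ 2 =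
    2 * (#|T|%:R * \sum_t a t ^+ 2) - 2 * (\sum_t a t) ^+ 2 by move=> ?; lra.
under eq_bigr => t _.
  under eq_bigr => r _ do rewrite sqrrB.
  rewrite big_split /= sumrB sumr_const -mulr_natl sumrMnl -mulr_sumr.
  over.
rewrite big_split /= sumrB sumr_const -mulr_natl -mulr_sumr.
rewrite sumrMnl -mulr_suml -[X in _ + X]mulr_natl -[X in _ - X + _]mulr_natl.
by ring.
Qed.

(* Minkowski's inequality, with [h] and [k] the L2 norms of [a] and [b] for total
   mass [c] (possibly 0). *)
Lemma sqr_norm_sub_le (T : finType) (P : pred T) (a b : T -> R) (c h k : R) :
  0 <= h -> 0 <= k ->
  \sum_(t | P t) a t ^+ 2 = c * h ^+ 2 ->
  \sum_(t | P t) b t ^+ 2 = c * k ^+ 2 ->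
  c * (h - k) ^+ 2 <= \sum_(t | P t) (a t - b t) ^+ 2.
Proof.
move=> h0 k0 ha hb.
have vanish (f : T -> R) t : \sum_(t | P t) f t ^+ 2 = 0 -> P t -> f t = 0.
  move=> /eqP; rewrite psumr_eq0 => [/allP/(_ t)|? _]; last exact: sqr_ge0.
  by rewrite mem_index_enum => /(_ isT)/implyP H /H; rewrite sqrf_eq0 => /eqP.
have [hz|hn] := eqVneq h 0.
  rewrite hz sub0r sqrrN -hb; apply: ler_sum => t Pt.
  by rewrite (vanish a t) ?ha ?hz ?expr0n ?mulr0// sub0r sqrrN.
have [kz|kn] := eqVneq k 0.
  rewrite kz subr0 -ha; apply: ler_sum => t Pt.
  by rewrite (vanish b t) ?hb ?kz ?expr0n ?mulr0// subr0.
suff : 2 * \sum_(t | P t) a t * b t <= 2 * (c * (h * k)).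
  under [X in _ -> _ <= X]eq_bigr => t _ do rewrite sqrrB.
  rewrite big_split /= sumrB ha hb sumrMnl -mulr_natl => ?; nra.
have -> : 2 * (c * (h * k)) =
    \sum_(t | P t) (k / h * a t ^+ 2 + h / k * b t ^+ 2).
  by rewrite big_split /= -!mulr_sumr ha hb; field; apply/andP.
rewrite mulr_sumr; apply: ler_sum => t _.
have hp : 0 < h by rewrite lt0r hn.
have kp : 0 < k by rewrite lt0r kn.
rewrite -subr_ge0.
have -> : k / h * a t ^+ 2 + h / k * b t ^+ 2 - 2 * (a t * b t) =
  (k * a t - h * b t) ^+ 2 / (h * k) by field; apply/andP.
by rewrite divr_ge0 ?sqr_ge0// mulr_ge0.
Qed.

End Generalities.

(** * Unnormalised entropy on a finite set *)

Section Entropy.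
Variables (R : realType) (V : finType).

Definition Ent (C : {set V}) (F : V -> R) : R :=
  \sum_(u in C) F u * ln (F u)
  - (\sum_(u in C) F u) * ln ((\sum_(u in C) F u) / #|C|%:R).

(* Pointwise [x ln (x / m) - x + m >= (sqrt x - sqrt m)^2]; the mean minimises
   the quadratic deviation. *)
Lemma variance_le_Ent (g : V -> R) : (forall u, 0 <= g u) ->
  \sum_u g u ^+ 2 - (\sum_u g u) ^+ 2 / #|V|%:R
    <= Ent [set: V] (fun u => g u ^+ 2).
Proof.
move=> g0; rewrite /Ent cardsT.
have setTE (F : V -> R) : \sum_(u in [set: V]) F u = \sum_u F u.
  by apply: eq_bigl => u; rewrite inE.
rewrite !setTE.
set A := \sum_u g u ^+ 2; set B := \sum_u g u; set N := #|V|%:R.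
have A0 : 0 <= A by apply: sumr_ge0 => *; exact: sqr_ge0.
have [Az|An] := eqVneq A 0.
  have gz u : g u = 0.
    move: Az => /eqP; rewrite psumr_eq0 => [/allP/(_ u)|? _]; last exact: sqr_ge0.
    by rewrite mem_index_enum => /(_ isT)/implyP/(_ isT); rewrite sqrf_eq0 => /eqP.
  rewrite Az mul0r !subr0 (_ : B = 0); last by apply: big1 => u _; exact: gz.
  rewrite expr0n /= mul0r oppr0 addr0 big1 => // u _.
  by rewrite gz expr0n mul0r.
have Ap : 0 < A by rewrite lt0r An.
have Np : 0 < N.
  rewrite ltr0n; case: (posnP #|V|) => // V0.
  move: An; rewrite /A big1 ?eqxx// => u _.
  by have := card0_eq V0 u; rewrite !inE.
pose r := Num.sqrt (A / N).
have r2 : r ^+ 2 = A / N by rewrite sqr_sqrtr // divr_ge0 // ltW.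
have rp : 0 < r by rewrite sqrtr_gt0 divr_gt0.
have pt u : (g u - r) ^+ 2 <= g u ^+ 2 * ln (g u ^+ 2) - g u ^+ 2 * ln (A / N)
    - g u ^+ 2 + A / N.
  have [gz|gn] := eqVneq (g u) 0.
    by rewrite gz expr0n /= !mul0r sub0r sqrrN r2; lra.
  have gp : 0 < g u by rewrite lt0r gn g0.
  rewrite -mulrBr -r2 -ln_div ?posrE ?exprn_gt0//.
  rewrite -expr_div_n lnXn ?divr_gt0//.
  have := ln_inv_ge (divr_gt0 gp rp).
  rewrite invf_div => H.
  have : g u ^+ 2 * (1 - r / g u) <= g u ^+ 2 * ln (g u / r).
    by rewrite ler_wpM2l // sqr_ge0.
  rewrite -[ln _ *+ 2]mulr_natl.
  have -> : g u ^+ 2 * (1 - r / g u) = g u ^+ 2 - g u * r by field.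
  by move=> ?; nra.
have := ler_sum (index_enum V) (P := xpredT) (fun u _ => pt u).
rewrite !(big_split, sumrN) /= -mulr_suml -/A sumr_const -[_ *+ #|_|]mulr_natl -/N.
have -> : N * (A / N) = A by field; lra.
move=> H.
have E : \sum_u (g u - r) ^+ 2 = A - 2 * r * B + N * r ^+ 2.
  under eq_bigr => u _ do rewrite sqrrB.
  rewrite big_split sumrB /= sumr_const sumrMnl -mulr_suml -/A -/B.
  by rewrite -[X in _ + X]mulr_natl -[X in _ - X + _]mulr_natl -/N; ring.
suff : A - B ^+ 2 / N <= A - 2 * r * B + N * r ^+ 2 by move=> ?; lra.
rewrite -subr_ge0.
have -> : A - 2 * r * B + N * r ^+ 2 - (A - B ^+ 2 / N) = (N * r - B) ^+ 2 / N.
  by field; lra.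
by rewrite divr_ge0 ?sqr_ge0 // ltW.
Qed.

(** Multiply [ln |x| >= 1 - 1/|x|] by [2 x^2]. The remaining logarithm makes the bound strong when
    [g] has a small mean square; this is how a small maximal influence enters. *)
Lemma Ent_sqr_ge (g : V -> R) :
  2 * (\sum_u g u ^+ 2) - 2 * (\sum_u `|g u|)
    - (\sum_u g u ^+ 2) * ln ((\sum_u g u ^+ 2) / #|V|%:R)
  <= Ent [set: V] (fun u => g u ^+ 2).
Proof.
rewrite /Ent cardsT.
have setTE (F : V -> R) : \sum_(u in [set: V]) F u = \sum_u F u.
  by apply: eq_bigl => u; rewrite inE.
rewrite !setTE lerD2r !mulr_sumr -sumrB; apply: ler_sum => u _.
rewrite -(real_normK (num_real (g u))); set x := `|g u|.
have : 0 <= x by exact: normr_ge0.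
rewrite le_eqVlt => /predU1P[<-|x0]; first by rewrite expr0n /= !mul0r mulr0 subr0.
rewrite lnXn // -mulr_natl.
have : x ^+ 2 * (1 - x^-1) <= x ^+ 2 * ln x.
  by rewrite ler_wpM2l ?sqr_ge0 // ln_inv_ge.
have -> : x ^+ 2 * (1 - x^-1) = x ^+ 2 - x by field; lra.
by move=> ?; lra.
Qed.

End Entropy.

(** * Influences on Schreier graphs *)

Section Schreier.
(** Labels in [T] act by involutions, and conjugation by [s t] permutes the generators; this makes
    the Laplacian commute with every [s t]. *)
Variables (R : realType) (V T : finType) (s : T -> V -> V) (conj : T -> T -> T).
Hypothesis sK : forall t, involutive (s t).
Hypothesis conjI : forall t, injective (conj t).
Hypothesis s_conj : forall t r u, s t (s r u) = s (conj t r) (s t u).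
Hypothesis T_gt0 : (0 < #|T|)%N.
Implicit Types (f g : V -> R).

Let T0 : 0 < #|T|%:R :> R.
Proof. by rewrite ltr0n. Qed.

Definition avg f : V -> R := fun u => #|T|%:R^-1 * \sum_t f (s t u).
Definition lap f : V -> R := fun u => f u - avg f u.
(** The lazy walk, the mean of [f] and [avg f]. *)
Definition step f : V -> R := fun u => f u - lap f u / 2.
Definition dirichlet f : R := \sum_u f u * lap f u.
Definition deriv t f : V -> R := fun u => f u - f (s t u).

Lemma sum_shift t f : \sum_u f (s t u) = \sum_u f u.
Proof. by rewrite [RHS](reindex_inj (can_inj (@sK t))). Qed.

Lemma sum_avg f : \sum_u avg f u = \sum_u f u.
Proof.
rewrite -mulr_sumr exchange_big /=.
under eq_bigr => t _ do rewrite sum_shift.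
by rewrite sumr_const -[X in _ * X]mulr_natl mulKf ?gt_eqF.
Qed.

Lemma sum_mul_avg f g : \sum_u f u * avg g u = \sum_u avg f u * g u.
Proof.
under eq_bigr => u _ do rewrite /avg mulrCA mulr_sumr.
under [RHS]eq_bigr => u _ do rewrite /avg -mulrA mulr_suml.
rewrite -!mulr_sumr exchange_big [in RHS]exchange_big /=; congr (_ * _).
apply: eq_bigr => t _.
rewrite -(sum_shift t); apply: eq_bigr => u _.
by rewrite sK.
Qed.

Lemma sum_mul_lap f g : \sum_u f u * lap g u = \sum_u lap f u * g u.
Proof.
under eq_bigr => u _ do rewrite /lap mulrBr.
under [RHS]eq_bigr => u _ do rewrite /lap mulrBl.
by rewrite !sumrB sum_mul_avg.
Qed.

Lemma sum_deriv_sqr f t :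
  \sum_u deriv t f u ^+ 2 = 2 * \sum_u f u ^+ 2 - 2 * \sum_u f u * f (s t u).
Proof.
under eq_bigr => u _ do rewrite /deriv sqrrB.
by rewrite big_split /= sumrB sumrMnl (sum_shift t (fun u => f u ^+ 2)); ring.
Qed.

Lemma sum_sum_deriv_sqr f :
  \sum_t \sum_u deriv t f u ^+ 2 = 2 * #|T|%:R * dirichlet f.
Proof.
under eq_bigr => t _ do rewrite sum_deriv_sqr.
rewrite sumrB sumr_const -[X in X - _]mulr_natl -mulr_sumr exchange_big /=.
under [X in _ - _ * X]eq_bigr => u _ do rewrite -mulr_sumr.
rewrite /dirichlet /lap.
under [X in _ = _ * X]eq_bigr => u _ do rewrite mulrBr.
rewrite sumrB mulrBr; congr (_ - _).
  by under eq_bigr => u _ do rewrite expr2; ring.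
rewrite -mulrA; congr (_ * _); rewrite mulr_sumr; apply: eq_bigr => u _.
by rewrite /avg mulrCA mulVKf ?gt_eqF.
Qed.

Lemma dirichlet_ge0 f : 0 <= dirichlet f.
Proof.
have : 0 <= 2 * #|T|%:R * dirichlet f.
  by rewrite -sum_sum_deriv_sqr; do 2!apply: sumr_ge0 => ? _; exact: sqr_ge0.
by rewrite pmulr_rge0 // mulr_gt0.
Qed.

(** Sum [(f u + f (s t u))^2 >= 0] over [u] and [t]. In spectral terms, [lap] is at most 2. *)
Lemma dirichlet_le f : dirichlet f <= 2 * \sum_u f u ^+ 2.
Proof.
have : 2 * #|T|%:R * dirichlet f <= 2 * #|T|%:R * (2 * \sum_u f u ^+ 2).
  rewrite -sum_sum_deriv_sqr mulrC mulrA mulr_natr -sumr_const.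
  apply: ler_sum => t _; rewrite sum_deriv_sqr.
  have : 0 <= \sum_u (f u + f (s t u)) ^+ 2.
    by apply: sumr_ge0 => ? _; exact: sqr_ge0.
  under eq_bigr => u _ do rewrite sqrrD.
  rewrite big_split big_split /= sumrMnl (sum_shift t (fun u => f u ^+ 2)).
  by move=> ?; lra.
by rewrite ler_pM2l // mulr_gt0.
Qed.

Lemma sum_sqr_step_le f : \sum_u step f u ^+ 2 <= \sum_u f u ^+ 2.
Proof.
have stepE u : step f u = (f u + avg f u) / 2 by rewrite /step /lap; lra.
have le_avg : \sum_u avg f u ^+ 2 <= \sum_u f u ^+ 2.
  rewrite -[X in _ <= X](sum_avg (fun u => f u ^+ 2)).
  apply: ler_sum => u _; rewrite /avg exprMn.
  have := sum_sqr_le (fun t => f (s t u)) => H.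
  rewrite expr2 -mulrA ler_pM2l ?invr_gt0 //.
  by rewrite -(ler_pM2l T0) mulVKf // gt_eqF.
apply: (@le_trans _ _ (\sum_u (f u ^+ 2 + avg f u ^+ 2) / 2)).
  apply: ler_sum => u _; rewrite stepE -subr_ge0.
  have -> : (f u ^+ 2 + avg f u ^+ 2) / 2 - ((f u + avg f u) / 2) ^+ 2 =
    ((f u - avg f u) / 2) ^+ 2 by field.
  exact: sqr_ge0.
by rewrite -mulr_suml big_split /=; lra.
Qed.

(** Expand the square and drop [(lap f)^2 / 4]. Along the walk, the variance lost is thus at most
    the sum of the Dirichlet forms. *)
Lemma sum_sqr_step_ge f :
  \sum_u f u ^+ 2 - dirichlet f <= \sum_u step f u ^+ 2.
Proof.
rewrite -sumrB; apply: ler_sum => u _.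
have := sqr_ge0 (lap f u); rewrite /step => ?; nra.
Qed.

Lemma sum_step f : \sum_u step f u = \sum_u f u.
Proof. by rewrite /step sumrB -mulr_suml /lap sumrB sum_avg; lra. Qed.

Lemma step_ge0 f : (forall u, 0 <= f u) -> forall u, 0 <= step f u.
Proof.
move=> f0 u; have : 0 <= avg f u.
  by rewrite mulr_ge0 ?invr_ge0 ?ler0n // sumr_ge0.
by have := f0 u; rewrite /step /lap; lra.
Qed.

(** Moving [s t] past [s r] replaces [r] by [conj t r], which only permutes the sum over labels. *)
Lemma avg_deriv t f : avg (deriv t f) =1 deriv t (avg f).
Proof.
move=> u; rewrite /avg /deriv -mulrBr sumrB; congr (_ * (_ - _)).
rewrite [RHS](reindex_inj (@conjI t)) /=.
by apply: eq_bigr => r _; rewrite s_conj.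
Qed.

Lemma lap_deriv t f : lap (deriv t f) =1 deriv t (lap f).
Proof. by move=> u; rewrite /lap avg_deriv /deriv; ring. Qed.

Lemma step_deriv t f : step (deriv t f) =1 deriv t (step f).
Proof. by move=> u; rewrite /step lap_deriv /deriv; ring. Qed.

Lemma sum_norm_step_le f : \sum_u `|step f u| <= \sum_u `|f u|.
Proof.
apply: (@le_trans _ _ (\sum_u (`|f u| + avg (fun u => `|f u|) u) / 2)); last first.
  by rewrite -mulr_suml big_split /= sum_avg; lra.
apply: ler_sum => u _.
have -> : step f u = (f u + avg f u) / 2 by rewrite /step /lap; lra.
rewrite normrM [`|2^-1|]ger0_norm ?invr_ge0 ?ler0n // ler_pM2r ?invr_gt0 ?ltr0n //.
apply: le_trans (ler_normD _ _) _; rewrite lerD2l /avg normrM ger0_norm.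
  by rewrite ler_pM2l ?invr_gt0 // ler_norm_sum.
by rewrite invr_ge0 ler0n.
Qed.

(** By self-adjointness the drop equals [|lap f|^2 - dirichlet (lap f) / 4], and [dirichlet_le]
    bounds the subtracted term by half of [|lap f|^2]. Laziness of the walk is what makes the drop
    positive. *)
Lemma dirichlet_step f :
  (\sum_u lap f u ^+ 2) / 2 <= dirichlet f - dirichlet (step f).
Proof.
have lapstep u : lap (step f) u = lap f u - lap (lap f) u / 2.
  rewrite /lap /step /avg sumrB -mulr_suml /lap /avg sumrB.
  by rewrite -mulr_sumr; ring.
have -> : dirichlet (step f) = dirichlet f - \sum_u lap f u ^+ 2
    + dirichlet (lap f) / 4.
  rewrite /dirichlet; under eq_bigr => u _.
    rewrite lapstep /step.
    have -> : (f u - lap f u / 2) * (lap f u - lap (lap f) u / 2) =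
       f u * lap f u - lap f u ^+ 2 / 2 - f u * lap (lap f) u / 2
       + lap f u * lap (lap f) u / 4 by field.
    over.
  rewrite big_split /= !sumrB -!mulr_suml sum_mul_lap.
  by under [X in _ - _ - X / _ + _]eq_bigr => u _ do rewrite -expr2; field.
by have := dirichlet_le (lap f); lra.
Qed.

(** Averaging [f - f (s t _)] over [t] gives [lap f]. The outcome [|lap f|^2] is the quantity that
    [dirichlet_step] charges to the decrease of the Dirichlet form. *)
Lemma sum_dirichlet_deriv f :
  \sum_t dirichlet (deriv t f) = 2 * #|T|%:R * \sum_u lap f u ^+ 2.
Proof.
have E t : dirichlet (deriv t f) =
    2 * (\sum_u f u * lap f u - \sum_u f (s t u) * lap f u).
  rewrite /dirichlet; under eq_bigr => u _.
    rewrite lap_deriv /deriv.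
    have -> : (f u - f (s t u)) * (lap f u - lap f (s t u)) =
       f u * lap f u + f (s t u) * lap f (s t u)
       - (f (s t u) * lap f u + f u * lap f (s t u)) by ring.
    over.
  rewrite sumrB !big_split /= (sum_shift t (fun u => f u * lap f u)).
  have -> : \sum_u f u * lap f (s t u) = \sum_u f (s t u) * lap f u.
    by rewrite -(sum_shift t); apply: eq_bigr => u _; rewrite sK.
  ring.
under eq_bigr => t _ do rewrite E.
rewrite -mulr_sumr -mulrA sumrB sumr_const -[X in X - _]mulr_natl.
rewrite exchange_big /=.
under [X in _ - X]eq_bigr => u _ do rewrite -mulr_suml.
congr (_ * _); rewrite !mulr_sumr -sumrB; apply: eq_bigr => u _.
have -> : \sum_t f (s t u) = #|T|%:R * avg f u by rewrite mulVKf ?gt_eqF.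
by rewrite /lap; ring.
Qed.

(** * From log-Sobolev to influences along the lazy walk *)

Section LogSobolev.
Variables (K M : R) (f : V -> R) (m : nat).
Hypothesis logSobolev : forall g,
  Ent [set: V] (fun u => g u ^+ 2) <= K * dirichlet g.
Hypothesis M_gt0 : 0 < M.
Hypothesis M_le : M <= 2^-1.
Hypothesis f01 : forall u, (f u == 0) || (f u == 1).
Hypothesis influence_le : forall t,
  \sum_u deriv t f u ^+ 2 <= 2 * M * #|V|%:R.
Hypothesis K_ge1 : 1 <= K.
Hypothesis m_ge : K <= m%:R.

Let F k := iter k step f.
Let psi k := dirichlet (F k).

Let F_ge0 k u : 0 <= F k u.
Proof.
elim: k u => [|k IH] u /=; last exact: step_ge0.
by rewrite /F /=; case/orP: (f01 u) => /eqP ->.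
Qed.

Let deriv_F k t : deriv t (F k.+1) =1 step (deriv t (F k)).
Proof. by move=> u; rewrite step_deriv. Qed.

(** Derivatives of a 0/1 function take values in {-1, 0, 1}, so at time 0 the L1 norm is the squared
    L2 norm; afterwards the walk contracts L1. *)
Let sum_norm_deriv_F k t :
  \sum_u `|deriv t (F k) u| <= \sum_u deriv t f u ^+ 2.
Proof.
elim: k => [|k IH].
  apply: ler_sum => u _; rewrite /deriv /=.
  by case/orP: (f01 u) => /eqP ->; case/orP: (f01 (s t u)) => /eqP ->;
    rewrite ?(subrr, subr0, sub0r, normrN, sqrrN, normr0, normr1, expr1n, expr0n).
apply: le_trans IH; under eq_bigr => u _ do rewrite deriv_F.
exact: sum_norm_step_le.
Qed.

Let sum_sqr_deriv_F k t :
  \sum_u deriv t (F k) u ^+ 2 <= \sum_u deriv t f u ^+ 2.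
Proof.
elim: k => [//|k IH].
apply: le_trans IH; under eq_bigr => u _ do rewrite deriv_F.
exact: sum_sqr_step_le.
Qed.

Let Ent_deriv_ge k t :
  (2 - ln (2 * M)) * (\sum_u deriv t (F k) u ^+ 2)
    - 2 * \sum_u deriv t f u ^+ 2
  <= Ent [set: V] (fun u => deriv t (F k) u ^+ 2).
Proof.
apply: le_trans (Ent_sqr_ge _).
have := sum_norm_deriv_F k t; have := sum_sqr_deriv_F k t.
have := influence_le t.
set a := \sum_u deriv t (F k) u ^+ 2; set b := \sum_u deriv t f u ^+ 2.
set c := \sum_u `|_| => bM ab cb.
have : 0 <= a by apply: sumr_ge0 => ? _; exact: sqr_ge0.
rewrite le_eqVlt => /predU1P[a0|a0]; first by rewrite -a0; lra.
have MV : 0 < 2 * M * #|V|%:R by lra.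
have V0 : 0 < #|V|%:R :> R by move: MV; rewrite pmulr_rgt0 // mulr_gt0.
(* The mean square [a / #|V|] never exceeds its initial value, hence is at most [2 M]. *)
suff : a * ln (a / #|V|%:R) <= a * ln (2 * M) by move=> ?; lra.
rewrite ler_pM2l // ler_ln ?posrE ?divr_gt0 ?mulr_gt0 //.
by rewrite ler_pdivrMr //; lra.
Qed.

Let psi_decay k :
  2 * ln (1 / M) * psi k <= 4 * K * (psi k - psi k.+1) + 4 * psi 0.
Proof.
have K0 : 0 < K by exact: lt_le_trans K_ge1.
have H1 : \sum_t ((2 - ln (2 * M)) * (\sum_u deriv t (F k) u ^+ 2)
    - 2 * \sum_u deriv t f u ^+ 2) <= \sum_t K * dirichlet (deriv t (F k)).
  apply: ler_sum => t _; apply: le_trans (Ent_deriv_ge k t) _.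
  exact: logSobolev.
move: H1; rewrite sumrB -!mulr_sumr !sum_sum_deriv_sqr sum_dirichlet_deriv.
rewrite -/(psi k) -[dirichlet f]/(psi 0) => H1.
have {}H1 : (2 - ln (2 * M)) * psi k - 2 * psi 0 <= K * \sum_u lap (F k) u ^+ 2.
  by rewrite -(ler_pM2l (mulr_gt0 (ltr0n R 2) T0)); lra.
have := dirichlet_step (F k); rewrite -/(psi k) -[dirichlet _]/(psi k.+1).
rewrite -(ler_pM2l K0) => H2.
(* The factor 2 in [2 * M] costs [ln 2 <= 1], which the constant in [2 - ln (2 * M)] covers. *)
have L : ln (1 / M) - 2 <= - ln (2 * M) - 1.
  rewrite div1r lnV ?posrE // lnM ?posrE //.
  by have := @ln_le_sub1 R 2; rewrite ltr0n => /(_ isT); lra.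
have psi0 : 0 <= psi k by exact: dirichlet_ge0.
have := ler_wpM2r psi0 L => ?; lra.
Qed.

Let varF k := \sum_u F k u ^+ 2 - (\sum_u f u) ^+ 2 / #|V|%:R.

(** The Poincare inequality, obtained from log-Sobolev through [variance_le_Ent]; the latter applies
    because [F k >= 0], and the walk preserves the sum. *)
Let varF_le k : varF k <= K * psi k.
Proof.
apply: le_trans (logSobolev _); apply: le_trans (variance_le_Ent (F_ge0 k)).
suff -> : \sum_u F k u = \sum_u f u by [].
by elim: k => //= k <-; exact: sum_step.
Qed.

Let varF_anti i k : (i <= k)%N -> varF k <= varF i.
Proof.
elim: k => [|k IH]; first by rewrite leqn0 => /eqP ->.
rewrite leq_eqVlt => /predU1P[-> //|]; rewrite ltnS => /IH.
by apply: le_trans; rewrite lerD2r sum_sqr_step_le.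
Qed.

Let varF_diff k : varF 0 - varF k <= \sum_(i < k) psi i.
Proof.
elim: k => [|k IH]; first by rewrite subrr big_ord0.
rewrite big_ord_recr /=; have := sum_sqr_step_ge (F k); rewrite -/(psi k).
by move: IH; rewrite /varF /=; lra.
Qed.

(** Let [P] be the sum of the first [m] Dirichlet forms. The variance lost by time [m] is at most
    [P]. So is the variance left then: it is nonincreasing, so Poincare at each earlier time gives
    [m * varF m <= K * P], with [K <= m]. Hence the variance of [f] is at most [2 P], and
    telescoping [psi_decay] bounds [P]. *)
Lemma talagrand_Schreier :
  ln (1 / M) * (\sum_u f u ^+ 2 - (\sum_u f u) ^+ 2 / #|V|%:R)
  <= 4 * (K + m%:R) * dirichlet f.
Proof.
have K0 : 0 < K by exact: lt_le_trans K_ge1.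
have L0 : 0 <= ln (1 / M).
  by apply: ln_ge0; rewrite ler_pdivlMr // mul1r; have := M_le; lra.
have psi0 k : 0 <= psi k by exact: dirichlet_ge0.
set P := \sum_(i < m) psi i.
have P0 : 0 <= P by apply: sumr_ge0 => i _; exact: psi0.
have Hm : m%:R * varF m <= K * P.
  rewrite mulr_sumr mulr_natl -[X in _ *+ X]card_ord -sumr_const.
  apply: ler_sum => i _; apply: le_trans (varF_le i).
  exact/varF_anti/ltnW.
have Vm : varF m <= P.
  case: (leP (varF m) 0) => [/le_trans -> //|v0].
  rewrite -(ler_pM2l K0); apply: le_trans Hm.
  by rewrite ler_pM2r.
have V0 : varF 0 <= 2 * P by have := varF_diff m; rewrite -/P; lra.
have D k : 2 * ln (1 / M) * (\sum_(i < k) psi i)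
    <= 4 * K * (psi 0 - psi k) + 4 * k%:R * psi 0.
  elim: k => [|k IH]; first by rewrite big_ord0 subrr; lra.
  rewrite big_ord_recr /= mulrDr.
  by have := psi_decay k; rewrite [k.+1%:R]mulrS; lra.
have := ler_wpM2l L0 V0; rewrite -[dirichlet f]/(psi 0).
have := mulr_ge0 (ltW K0) (psi0 m); have := D m; rewrite -/P.
by rewrite /varF /= => ? ? ?; lra.
Qed.

End LogSobolev.
End Schreier.

(** * The one-site inequality *)

Section OneSite.
Variable R : realType.

(** The chain rule of entropy; the last bracket is the entropy of the class averages, to be handled
    by the one-site inequality. *)
Lemma Ent_partition (V I : finType) (C : {set V}) (p : V -> I) (F : V -> R) :
  let C_ i := [set u in C | p u == i] in
  Ent C F = \sum_i Ent (C_ i) F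
    + (\sum_i (\sum_(u in C_ i) F u) * ln ((\sum_(u in C_ i) F u) / #|C_ i|%:R)
       - (\sum_(u in C) F u) * ln ((\sum_(u in C) F u) / #|C|%:R)).
Proof.
rewrite /= /Ent sumrB.
have -> : \sum_(u in C) F u * ln (F u) =
    \sum_i \sum_(u in [set u in C | p u == i]) F u * ln (F u).
  rewrite (partition_big p xpredT) //=; apply: eq_bigr => i _.
  by apply: eq_bigl => u; rewrite inE.
by ring.
Qed.

(** For [x <= 2], [ln x <= x - 1] gives the factor [2 x + 1 <= 5]. For [x > 2], [x^2 <= 4 (x - 1)^2]
    and [ln x <= ln y] give [8 ln y]. *)
Lemma xlnx_sqr_le (x y K : R) : 0 <= x -> x <= y -> 1 <= y -> 5 + 8 * ln y <= K ->
  x ^+ 2 * ln (x ^+ 2) - x ^+ 2 + 1 <= K * (x - 1) ^+ 2.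
Proof.
move=> x0 xy y1 HK; have ly : 0 <= ln y by exact: ln_ge0.
move: x0; rewrite le_eqVlt => /predU1P[<-|x0].
  by rewrite expr0n /= mul0r !sub0r sqrrN expr1n; lra.
rewrite lnXn // -mulr_natl; have sq := sqr_ge0 (x - 1).
have [x2|x2] := leP x 2.
  have H : x ^+ 2 * ln x <= x ^+ 2 * (x - 1).
    by rewrite ler_wpM2l ?sqr_ge0 // ln_le_sub1.
  apply: (@le_trans _ _ ((2 * x + 1) * (x - 1) ^+ 2)); last first.
    by rewrite ler_wpM2r //; lra.
  have -> : (2 * x + 1) * (x - 1) ^+ 2 = 2 * (x ^+ 2 * (x - 1)) - x ^+ 2 + 1 by ring.
  by lra.
have lxy : ln x <= ln y by rewrite ler_ln ?posrE //; exact: lt_le_trans xy.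
have H : x ^+ 2 * ln x <= x ^+ 2 * ln y by rewrite ler_wpM2l ?sqr_ge0.
have H1 : 0 <= ln y * (4 * (x - 1) ^+ 2 - x ^+ 2) by rewrite mulr_ge0 //; nra.
have H2 : (8 * ln y) * (x - 1) ^+ 2 <= K * (x - 1) ^+ 2.
  by rewrite ler_wpM2r //; lra.
have : 1 <= x ^+ 2 by nra.
by move=> ?; lra.
Qed.

(** The right side is [K] times the variance of [h] under the weights [q]. After division by the
    mean [m], the claim reduces to [xlnx_sqr_le] at each [i]; the logarithm of [N / q i] appears
    because an atom of mass [q i] forces [h i <= m * N / q i]. *)
Lemma one_site_logSobolev (I : finType) (q h : I -> R) (N K : R) :
  (forall i, 0 <= q i) -> (forall i, 0 <= h i) -> \sum_i q i = N -> 0 < N ->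
  5 <= K -> (forall i, 0 < q i -> 5 + 8 * ln (N / q i) <= K) ->
  \sum_i q i * h i ^+ 2 * ln (h i ^+ 2)
    - (\sum_i q i * h i ^+ 2) * ln ((\sum_i q i * h i ^+ 2) / N)
  <= K / (2 * N) * \sum_i \sum_k q i * q k * (h i - h k) ^+ 2.
Proof.
move=> q0 h0 Nq N0 K5 HK.
set A := \sum_i q i * h i ^+ 2; pose m := (\sum_i q i * h i) / N.
have Nm : \sum_i q i * h i = N * m by rewrite mulrC divfK // gt_eqF.
have m0 : 0 <= m.
  by rewrite divr_ge0 ?(ltW N0) // sumr_ge0 // => i _; exact: mulr_ge0.
clearbody m.
have A0 : 0 <= A by apply: sumr_ge0 => i _; rewrite mulr_ge0 ?sqr_ge0.
have -> : K / (2 * N) * \sum_i \sum_k q i * q k * (h i - h k) ^+ 2 =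
    K * (A - N * m ^+ 2).
  have -> : \sum_i \sum_k q i * q k * (h i - h k) ^+ 2 =
      \sum_i (q i * h i ^+ 2 * N + q i * A - 2 * (q i * h i) * (N * m)).
    apply: eq_bigr => i _.
    rewrite -Nm -Nq /A !mulr_sumr -big_split -sumrB /=.
    by apply: eq_bigr => k _; ring.
  rewrite sumrB big_split /= -!mulr_suml -mulr_sumr -/A Nq Nm.
  by field; exact: lt0r_neq0.
move: m0; rewrite le_eqVlt => /predU1P[mz|m0].
  have qh i : q i * h i = 0.
    move: Nm; rewrite -mz mulr0 => /eqP.
    rewrite psumr_eq0 => [/allP/(_ i)|k _]; last exact: mulr_ge0.
    by rewrite mem_index_enum => /(_ isT)/implyP/(_ isT)/eqP.
  have Az : A = 0.
    by rewrite /A big1 // => i _; rewrite expr2 mulrA qh mul0r.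
  rewrite Az mul0r subr0 big1 => [|i _]; last first.
    by rewrite expr2 mulrA qh !mul0r.
  by rewrite -mz; lra.
have m2 : 0 < m ^+ 2 by rewrite exprn_gt0.
(* The function [t ln t] at [A / N] lies above its tangent at [m^2]. *)
have HA : A * ln (m ^+ 2) + A - N * m ^+ 2 <= A * ln (A / N).
  move: A0; rewrite le_eqVlt => /predU1P[<-|A0].
    by rewrite !mul0r; have := mulr_gt0 N0 m2; lra.
  have := ln_inv_ge (divr_gt0 (divr_gt0 A0 N0) m2).
  rewrite [ln (_ / m ^+ 2)]ln_div ?posrE ?divr_gt0 // => H.
  have := ler_wpM2l (ltW A0) H.
  have -> : A * (1 - (A / N / m ^+ 2)^-1) = A - N * m ^+ 2.
    by field; rewrite !gt_eqF.
  by move=> ?; lra.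
(* [x^2 ln x^2 - x^2 + 1 <= K (x - 1)^2] at [x = h i / m <= N / q i] *)
have pt i : q i * h i ^+ 2 * ln (h i ^+ 2) - q i * h i ^+ 2 * ln (m ^+ 2)
   - q i * h i ^+ 2 + q i * m ^+ 2 <=
   K * (q i * h i ^+ 2 - 2 * (q i * h i) * m + q i * m ^+ 2).
  have := q0 i; rewrite le_eqVlt => /predU1P[<-|qi]; first by rewrite !mul0r; lra.
  have qN : q i <= N by rewrite -Nq (bigD1 i) //= lerDl sumr_ge0.
  have hy : h i / m <= N / q i.
    rewrite ler_pdivrMr // mulrAC ler_pdivlMr // -Nm mulrC.
    by rewrite (bigD1 i) //= lerDl sumr_ge0 // => k _; exact: mulr_ge0.
  have y1 : 1 <= N / q i by rewrite ler_pdivlMr // mul1r.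
  have := xlnx_sqr_le (divr_ge0 (h0 i) (ltW m0)) hy y1 (HK i qi).
  have qm : 0 < q i * m ^+ 2 by exact: mulr_gt0.
  rewrite -(ler_pM2l qm).
  have -> : q i * m ^+ 2 * (K * (h i / m - 1) ^+ 2) =
     K * (q i * h i ^+ 2 - 2 * (q i * h i) * m + q i * m ^+ 2).
    by field; rewrite gt_eqF.
  move=> /(le_trans _) -> //.
  have := h0 i; rewrite le_eqVlt => /predU1P[<-|hi].
    by rewrite mul0r expr0n /= mulr0 !mul0r; lra.
  rewrite expr_div_n ln_div ?posrE ?exprn_gt0 //.
  rewrite le_eqVlt; apply/orP; left; apply/eqP.
  by field; rewrite gt_eqF.
have := ler_sum (index_enum I) (P := xpredT) (fun i _ => pt i).
rewrite -mulr_sumr !(big_split, sumrN) /= -!mulr_suml -mulr_sumr -/A Nq Nm.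
by move=> ?; lra.
Qed.

(** * Harmonic numbers compared with logarithms *)

Definition harm (m : nat) : R := \sum_(i < m) i.+1%:R^-1.

Lemma harmS m : harm m.+1 = harm m + m.+1%:R^-1.
Proof. by rewrite /harm big_ord_recr. Qed.

Lemma harm_le k m : (k <= m)%N -> harm k <= harm m.
Proof.
elim: m => [|m IH]; first by rewrite leqn0 => /eqP ->.
rewrite leq_eqVlt => /predU1P[-> //|/IH/le_trans]; apply.
by rewrite harmS lerDl invr_ge0.
Qed.

Lemma harm_sub_le_ln k m : (0 < k)%N -> (k <= m)%N ->
  harm m - harm k <= ln (m%:R / k%:R).
Proof.
move=> k0; elim: m => [|m IH]; first by rewrite leqNgt k0.
rewrite leq_eqVlt => /predU1P[->|]; first by rewrite subrr divff ?ln1 ?pnatr_eq0 -?lt0n.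
rewrite ltnS => km; have := IH km; rewrite harmS.
have m0 : (0 < m)%N by exact: leq_trans km.
rewrite !ln_div ?posrE ?ltr0n //.
have := @ln_inv_ge R (m.+1%:R / m%:R); rewrite divr_gt0 ?ltr0n // => /(_ isT).
rewrite ln_div ?posrE ?ltr0n // invf_div.
have -> : 1 - m%:R / m.+1%:R = m.+1%:R^-1 :> R.
  by rewrite -natr1; field; rewrite natr1 pnatr_eq0.
move=> H1 H2; apply: le_trans (_ : m.+1%:R^-1 + (harm m - harm k) <= _).
  by rewrite addrA [_^-1 + _]addrC.
by apply: le_trans (lerD H1 H2) _; rewrite addrA subrK.
Qed.

Lemma ln_le_harm_sub k m : (0 < k)%N -> (k <= m)%N ->
  ln (m%:R / k%:R) <= harm m - harm k + 1.
Proof.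
(* This stronger form passes the induction: [ln ((m+1)/m) <= 1/m], and the excess [1/m - 1/(m+1)]
   telescopes. *)
move=> k0 km; suff H : ln (m%:R / k%:R) <= harm m - harm k + k%:R^-1 - m%:R^-1.
  apply: le_trans H _.
  have : k%:R^-1 <= 1 :> R by rewrite invf_le1 ?ltr0n // ler1n.
  have : 0 <= m%:R^-1 :> R by rewrite invr_ge0.
  by move: (_^-1) (_^-1) => a b ? ?; lra.
elim: m km => [|m IH]; first by rewrite leqNgt k0.
rewrite leq_eqVlt => /predU1P[->|]; first by rewrite divff ?ln1 ?pnatr_eq0 -?lt0n // addrK subrr.
rewrite ltnS => km; have := IH km; rewrite harmS.
have m0 : (0 < m)%N by exact: leq_trans km.
rewrite !ln_div ?posrE ?ltr0n //.
have := @ln_le_sub1 R (m.+1%:R / m%:R); rewrite divr_gt0 ?ltr0n // => /(_ isT).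
rewrite ln_div ?posrE ?ltr0n //.
have -> : m.+1%:R / m%:R - 1 = m%:R^-1 :> R.
  by rewrite -natr1; field; rewrite pnatr_eq0 -lt0n.
by move: (k%:R^-1) (m%:R^-1) (_.+1%:R^-1) => a b c ? ?; lra.
Qed.

End OneSite.

(** * Log-Sobolev inequality on the multislice *)

Section MultisliceLogSobolev.
Variables (R : realType) (l n : nat) (kappa : 'I_l -> nat).
Local Notation V := (multislice n kappa).
Implicit Types (u v w : V) (X : {set 'I_n}) (g : V -> R).

Definition swap u x y : V := Defs.act u (tperm x y).

Lemma swapE u x y j : swap u x y j = u (tperm x y j).
Proof. by rewrite /= ffunE. Qed.

Lemma word_ext u v : (forall j, u j = v j) -> u = v.
Proof. by move=> uv; apply: val_inj; apply/ffunP. Qed.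

Lemma swapK x y : involutive (fun u => swap u x y).
Proof. by move=> u; apply: word_ext => j; rewrite !swapE tpermK. Qed.

Lemma swapxx u x : swap u x x = u.
Proof. by apply: word_ext => j; rewrite swapE tperm1 perm1. Qed.

(** The coordinates in [X] are free and the others frozen at [w]: a smaller multislice, with
    histogram [mult X w]. *)
Definition slice X w : {set V} :=
  [set u : V | [forall j, (j \notin X) ==> (u j == w j)]].

Definition mult X u (i : 'I_l) : nat := #|[set j in X | u j == i]|.

Lemma sliceP X w u : reflect (forall j, j \notin X -> u j = w j) (u \in slice X w).
Proof.
rewrite inE; apply: (iffP forallP) => H j; first by move=> jX; apply/eqP/(implyP (H j)).
by apply/implyP => /H ->.
Qed.

Lemma slice_refl X w : w \in slice X w.
Proof. exact/sliceP. Qed.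

Lemma slice_swap X w u x y : x \in X -> y \in X ->
  (swap u x y \in slice X w) = (u \in slice X w).
Proof.
move=> xX yX; apply/sliceP/sliceP => H j jX; rewrite -(H j jX) ?swapE tpermD //.
all: by apply: contraNneq jX => <-.
Qed.

Lemma mult_slice X w u : u \in slice X w -> mult X u =1 mult X w.
Proof.
move=> /sliceP H i.
have E v : (mult X v i + #|[set j in ~: X | v j == i]|)%N = kappa i.
  have /forallP/(_ i)/eqP <- := wordP v.
  rewrite -(cardsID X [set j | v j == i]); congr (_ + _)%N; apply: eq_card => j.
    by rewrite !inE andbC.
  by rewrite !inE andbC.
apply/eqP; rewrite -(eqn_add2r #|[set j in ~: X | w j == i]|) E -(E u).
rewrite eqn_add2l; apply/eqP/eq_card => j; rewrite !inE.
by case: (boolP (j \in X)) => //= /H ->.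
Qed.

Lemma mult_setD1 X u i j : j \in X ->
  mult X u i = ((u j == i) + mult (X :\ j) u i)%N.
Proof.
move=> jX; rewrite /mult (cardsD1 j) inE jX /=; congr (_ + _)%N.
by apply: eq_card => k; rewrite !inE andbA.
Qed.

Lemma mult_le X u i : (mult X u i <= #|X|)%N.
Proof. by apply/subset_leq_card/subsetP => j; rewrite inE => /andP[]. Qed.

Definition letter X w j i : {set V} := [set u in slice X w | u j == i].

Lemma in_letter X w j i u :
  (u \in letter X w j i) = (u \in slice X w) && (u j == i).
Proof. by rewrite [LHS]in_set. Qed.

Lemma slice_setD1 X w v j : v \in slice X w -> j \in X ->
  slice (X :\ j) v = letter X w j (v j).
Proof.
move=> /sliceP vw jX; apply/setP => u; rewrite in_letter.
apply/sliceP/andP => [H|[/sliceP H /eqP uj] k].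
  split; last by rewrite H // !inE eqxx.
  by apply/sliceP => k kX; rewrite -vw // H // !inE (negPf kX) andbF.
rewrite !inE negb_and negbK => /orP[/eqP -> //|kX].
by rewrite H // vw.
Qed.

Lemma sum_mult (X : {set 'I_n}) u (G : 'I_l -> R) :
  \sum_(j in X) G (u j) = \sum_i (mult X u i)%:R * G i.
Proof.
rewrite (partition_big (fun j => u j) xpredT) //=; apply: eq_bigr => i _.
rewrite mulr_natl /mult -sumr_const; apply: eq_big => [j|j /andP[_ /eqP -> //]].
by rewrite inE.
Qed.

(** Double counting of pairs of a word and a coordinate of [X] carrying [i]; swapping [j] and [k]
    shows that every coordinate of [X] contributes equally. *)
Lemma card_letter X w j i : j \in X ->
  #|X|%:R * #|letter X w j i|%:R = #|slice X w|%:R * (mult X w i)%:R :> R.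
Proof.
move=> jX.
have E k : k \in X -> #|letter X w k i| = #|letter X w j i|.
  move=> kX; rewrite -(card_imset _ (can_inj (swapK j k))); apply: eq_card => u.
  apply/imsetP/idP => [[v]|].
    by move=> vS ->; move: vS; rewrite !in_letter slice_swap // swapE tpermL.
  move=> uS; exists (swap u j k); last by rewrite swapK.
  by move: uS; rewrite !in_letter slice_swap // swapE tpermR.
rewrite -!natrM; congr (_%:R); rewrite -sum_nat_const.
under eq_bigr => k kX do rewrite -(E k kX) -sum1_card.
under eq_bigr => k kX do under eq_bigl => u do rewrite in_letter.
rewrite (exchange_big_dep (mem (slice X w))) /= => [|k u _ /andP[] //].
rewrite -sum_nat_const; apply: eq_bigr => u uS.
rewrite -(mult_slice uS) /mult -sum1_card; apply: eq_bigl => k.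
by rewrite inE uS.
Qed.

Definition sqdiff g u x y : R := (g u - g (swap u x y)) ^+ 2.

(* Swapping site [j] with a site carrying [k] couples the words with letter
   [i] at [j] and those with letter [k] at [j]. *)
Lemma letter_coupling X w g j i k (hi hk : R) : j \in X -> 0 <= hi -> 0 <= hk ->
  \sum_(u in letter X w j i) g u ^+ 2 = #|letter X w j i|%:R * hi ^+ 2 ->
  \sum_(u in letter X w j k) g u ^+ 2 = #|letter X w j k|%:R * hk ^+ 2 ->
  #|letter X w j i|%:R * (mult X w k)%:R * (hi - hk) ^+ 2
  <= \sum_(u in letter X w j i) \sum_(y in X | u y == k) sqdiff g u j y.
Proof.
move=> jX hi0 hk0 Hi Hk.
have X0 : #|X|%:R != 0 :> R by rewrite pnatr_eq0 -lt0n; apply/card_gt0P; exists j.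
pose Q a b (p : V * 'I_n) := (p.1 \in letter X w j a) && ((p.2 \in X) && (p.1 p.2 == b)).
have sumQ a b : \sum_(p | Q a b p) g p.1 ^+ 2 =
    (mult X w b)%:R * \sum_(u in letter X w j a) g u ^+ 2.
  rewrite -(pair_big_dep (fun u => u \in letter X w j a)
    (fun u y => (y \in X) && (u y == b)) (fun u _ => g u ^+ 2)) /= mulr_sumr.
  apply: eq_bigr => u; rewrite in_letter => /andP[uS _].
  rewrite sumr_const -[LHS]mulr_natl -(mult_slice uS); congr (_%:R * _).
  by apply: eq_card => y; rewrite [RHS]inE.
rewrite (pair_big_dep (fun u => u \in letter X w j i)
    (fun u y => (y \in X) && (u y == k)) (fun u y => sqdiff g u j y)) /=.
apply: (sqr_norm_sub_le (a := fun p => g p.1) (b := fun p => g (swap p.1 j p.2))) => //.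
  by rewrite [LHS]sumQ Hi; ring.
pose phi (p : V * 'I_n) := (swap p.1 j p.2, p.2).
have phiK : involutive phi by case=> u y; rewrite /phi /= swapK.
rewrite (reindex_inj (can_inj phiK)) /=.
have -> : \sum_(p | Q i k (phi p)) g (swap (swap p.1 j p.2) j p.2) ^+ 2 =
    \sum_(p | Q k i p) g p.1 ^+ 2.
  apply: eq_big => [[u y]|[u y] _] /=; last by rewrite swapK.
  rewrite /Q /phi /= !in_letter swapE tpermL swapE tpermR.
  have [yX|_] := boolP (y \in X); last by rewrite !andbF.
  by rewrite slice_swap //= -!andbA; congr andb; rewrite andbC.
(* Multiplying by [#|X|] lets [card_letter] show that both sides of the coupling have the same total
   mass. *)
rewrite sumQ Hk; apply: (mulfI X0).
transitivity (#|X|%:R * #|letter X w j k|%:R * (mult X w i)%:R * hk ^+ 2).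
  by ring.
transitivity (#|X|%:R * #|letter X w j i|%:R * (mult X w k)%:R * hk ^+ 2).
  by rewrite !card_letter //; ring.
by ring.
Qed.

(** The one-site inequality with letter classes as weights and the root mean square of [g] on each
    class as [h]; [letter_coupling] turns differences between classes into swaps. *)
Lemma site_logSobolev X w g j : j \in X ->
  \sum_i (\sum_(u in letter X w j i) g u ^+ 2)
      * ln ((\sum_(u in letter X w j i) g u ^+ 2) / #|letter X w j i|%:R)
    - (\sum_(u in slice X w) g u ^+ 2)
      * ln ((\sum_(u in slice X w) g u ^+ 2) / #|slice X w|%:R)
  <= (13 + 8 * \sum_i (harm R #|X| - harm R (mult X w i))) / (2 * #|X|%:R)
     * \sum_(u in slice X w) \sum_(y in X) sqdiff g u j y.
Proof.
move=> jX; pose A i := \sum_(u in letter X w j i) g u ^+ 2.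
(* Here [13 = 5 + 8]: the 8 pays for the error 1 in [ln_le_harm_sub]. Each letter's harmonic
   difference is bounded by the sum over all letters. *)
set K := 13 + _.
have N0 : 0 < #|slice X w|%:R :> R.
  by rewrite ltr0n; apply/card_gt0P; exists w; exact: slice_refl.
have X0 : 0 < #|X|%:R :> R by rewrite ltr0n; apply/card_gt0P; exists j.
have d0 i : 0 <= harm R #|X| - harm R (mult X w i).
  by rewrite subr_ge0 harm_le // mult_le.
have d1 i : harm R #|X| - harm R (mult X w i) <=
    \sum_i (harm R #|X| - harm R (mult X w i)).
  by rewrite (bigD1 i) //= lerDl sumr_ge0.
have dsum : 0 <= \sum_i (harm R #|X| - harm R (mult X w i)) by rewrite sumr_ge0.
have A0 i : 0 <= A i by apply: sumr_ge0 => u _; exact: sqr_ge0.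
pose h i := Num.sqrt (A i / #|letter X w j i|%:R).
have h0 i : 0 <= h i by exact: sqrtr_ge0.
have h2 i : h i ^+ 2 = A i / #|letter X w j i|%:R.
  by rewrite sqr_sqrtr // divr_ge0.
have nh2 i : A i = #|letter X w j i|%:R * h i ^+ 2.
  rewrite h2; have [n0|n0] := eqVneq (#|letter X w j i|%:R : R) 0; last first.
    by rewrite mulrC divfK.
  rewrite n0 mul0r /A big_pred0 // => u; apply: card0_eq.
  by apply/eqP; rewrite -(pnatr_eq0 R) n0.
have split_slice (F : V -> R) :
    \sum_(u in slice X w) F u = \sum_i \sum_(u in letter X w j i) F u.
  rewrite (partition_big (fun u => u j) xpredT) //=; apply: eq_bigr => i _.
  by apply: eq_bigl => u; rewrite in_letter.
have Nsum : \sum_i #|letter X w j i|%:R = #|slice X w|%:R :> R.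
  rewrite -[RHS](sumr_const (mem (slice X w)) 1) split_slice.
  by apply: eq_bigr => i _; rewrite sumr_const.
have K5 : 5 <= K by rewrite /K; lra.
have HK i : 0 < #|letter X w j i|%:R :> R ->
    5 + 8 * ln (#|slice X w|%:R / #|letter X w j i|%:R) <= K.
  move=> n0; have Ei := card_letter w i jX.
  have k0 : 0 < (mult X w i)%:R :> R.
    by rewrite -(pmulr_rgt0 _ N0) -Ei mulr_gt0.
  have -> : #|slice X w|%:R / #|letter X w j i|%:R = #|X|%:R / (mult X w i)%:R :> R.
    by apply/eqP; rewrite eqr_div ?lt0r_neq0 // -Ei.
  have := @ln_le_harm_sub R _ _ (_ : (0 < mult X w i)%N) (mult_le X w i).
  rewrite -(ltr0n R) => /(_ k0); have := d1 i; rewrite /K.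
  by move=> ? ?; lra.
have := one_site_logSobolev (fun i => ler0n R _) h0 Nsum N0 K5 HK.
under [X in X - _ * _ <= _]eq_bigr => i _ do rewrite -nh2 h2.
rewrite -(eq_bigr _ (fun i _ => nh2 i)) /= -[\sum_i A i]split_slice.
move=> /le_trans -> //.
have -> : \sum_(u in slice X w) \sum_(y in X) sqdiff g u j y =
    \sum_i \sum_k \sum_(u in letter X w j i) \sum_(y in X | u y == k) sqdiff g u j y.
  rewrite split_slice; apply: eq_bigr => i _; rewrite [RHS]exchange_big /=.
  by apply: eq_bigr => u _; rewrite (partition_big (fun y => u y) xpredT).
rewrite !mulr_sumr; apply: ler_sum => i _; rewrite !mulr_sumr; apply: ler_sum => k _.
have K0 : 0 < K by lra.
have := letter_coupling jX (h0 i) (h0 k) (nh2 i) (nh2 k) => H.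
have c0 : 0 < K / (2 * #|X|%:R) by rewrite divr_gt0 // mulr_gt0.
rewrite -(ler_pM2l c0) in H; apply: le_trans H.
rewrite le_eqVlt; apply/orP; left; apply/eqP.
have -> : (mult X w k)%:R = #|X|%:R * #|letter X w j k|%:R / #|slice X w|%:R :> R.
  by rewrite (card_letter w k jX) mulrAC divff ?mul1r // gt_eqF.
by field; rewrite !gt_eqF.
Qed.

(* As [harm] has increments [1/k], freeing or fixing one coordinate changes [pot]
   by an explicit amount, also for letters of multiplicity 0 or 1. *)
Definition pot X u : R := \sum_i (12 + 4 * (harm R #|X| - harm R (mult X u i))).

Lemma potE X u :
  pot X u = 12 * l%:R + 4 * \sum_i (harm R #|X| - harm R (mult X u i)).
Proof. by rewrite /pot big_split /= -mulr_sumr sumr_const card_ord mulr_natr. Qed.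

Lemma pot_slice X w u : u \in slice X w -> pot X u = pot X w.
Proof. by move=> /mult_slice E; apply: eq_bigr => i _; rewrite E. Qed.

Lemma pot_setD1 X u j : j \in X ->
  pot (X :\ j) u = pot X u - 4 * l%:R / #|X|%:R + 4 / (mult X u (u j))%:R.
Proof.
move=> jX.
have -> : 4 / (mult X u (u j))%:R = \sum_i (u j == i)%:R * (4 / (mult X u i)%:R) :> R.
  rewrite (bigD1 (u j)) //= eqxx mul1r big1 ?addr0 // => i; rewrite eq_sym => /negPf ->.
  by rewrite mul0r.
have -> : 4 * l%:R / #|X|%:R = \sum_(i < l) 4 / #|X|%:R :> R.
  by rewrite sumr_const card_ord -[in RHS]mulr_natl; ring.
rewrite /pot -sumrB -big_split /=; apply: eq_bigr => i _.
rewrite (cardsD1 j X) jX (mult_setD1 u i jX) /= !add1n harmS.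
case: eqP => _ /=; last by rewrite add0n; ring.
by rewrite add1n harmS; ring.
Qed.

(** Each letter present in [X] gains [4 / mult] at [mult] coordinates, so the total gain is at most
    [4 l], which balances the total loss [4 l]. *)
Lemma sum_pot_setD1_le X u : \sum_(j in X) pot (X :\ j) u <= #|X|%:R * pot X u.
Proof.
have [X0|X0] := posnP #|X|.
  by rewrite X0 mul0r big_pred0 // => j; exact: (card0_eq X0).
under eq_bigr => j jX do rewrite (pot_setD1 _ jX).
rewrite big_split /= sumr_const -[X in X + _ <= _]mulr_natl.
rewrite (sum_mult X u (fun i => 4 / (mult X u i)%:R)).
have : \sum_i (mult X u i)%:R * (4 / (mult X u i)%:R) <= 4 * l%:R :> R.
  have -> : 4 * l%:R = \sum_(i < l) 4 :> R by rewrite sumr_const card_ord mulr_natr.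
  apply: ler_sum => i _.
  have [->|k0] := eqVneq (mult X u i)%:R (0 : R); first by rewrite mul0r.
  by rewrite mulrCA divff ?mulr1.
have -> : #|X|%:R * (pot X u - 4 * l%:R / #|X|%:R) = #|X|%:R * pot X u - 4 * l%:R.
  by field; rewrite pnatr_eq0 -lt0n.
by move=> ?; lra.
Qed.

(** A pair [x != y] survives the removal of [j] unless [j] is [x] or [y]. By [pot_setD1] each of
    these two missing potentials is at least [pot X u - 4 l / #|X|]. *)
Lemma sum_sqdiff_setD1_le X u g :
  \sum_(j in X) pot (X :\ j) u * \sum_(x in X :\ j) \sum_(y in X :\ j) sqdiff g u x y
  <= ((#|X|%:R - 2) * pot X u + 8 * l%:R / #|X|%:R)
     * \sum_(x in X) \sum_(y in X) sqdiff g u x y.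
Proof.
have -> : \sum_(j in X) pot (X :\ j) u *
      \sum_(x in X :\ j) \sum_(y in X :\ j) sqdiff g u x y =
    \sum_(x in X) \sum_(y in X) sqdiff g u x y
      * \sum_(j in X | (j != x) && (j != y)) pot (X :\ j) u.
  under eq_bigr => j _ do rewrite mulr_sumr.
  rewrite (exchange_big_dep (mem X)) /= => [|j x _]; last by rewrite inE => /andP[].
  apply: eq_bigr => x xX.
  under eq_bigr => j _ do rewrite mulr_sumr.
  rewrite (exchange_big_dep (mem X)) /= => [|j y _]; last by rewrite inE => /andP[].
  apply: eq_bigr => y yX; rewrite mulr_sumr; apply: eq_big => [j|j _]; last first.
    by rewrite mulrC.
  by rewrite !inE xX yX !andbT -andbA [x == _]eq_sym [y == _]eq_sym.
rewrite mulr_sumr; apply: ler_sum => x xX; rewrite mulr_sumr; apply: ler_sum => y yX.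
rewrite mulrC; have [->|xy] := eqVneq y x.
  by rewrite /sqdiff swapxx subrr expr0n !mulr0.
rewrite ler_wpM2r ?sqr_ge0 //.
have := sum_pot_setD1_le X u.
rewrite (bigD1 x) //= (bigD1 y) /= ?yX //.
under eq_bigl => j do rewrite -andbA.
rewrite !pot_setD1 //; set S := \sum_(j in X | _) _.
have : 0 <= 4 / (mult X u (u x))%:R :> R by rewrite divr_ge0.
have : 0 <= 4 / (mult X u (u y))%:R :> R by rewrite divr_ge0.
have -> : 8 * l%:R / #|X|%:R = 2 * (4 * l%:R / #|X|%:R) :> R by ring.
move: (4 / _) (4 / _) (4 * l%:R / _) => a b c ? ? ?; lra.
Qed.

Lemma multislice_logSobolev X w g :
  Ent (slice X w) (fun u => g u ^+ 2)
  <= pot X w / #|X|%:R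
     * \sum_(u in slice X w) \sum_(x in X) \sum_(y in X) sqdiff g u x y.
Proof.
have [m] := ubnP #|X|; elim: m => // m IH in X w *; rewrite ltnS => Xm.
have [X0|X0] := posnP #|X|.
  have SE : slice X w = [set w].
    apply/setP => u; rewrite [RHS]inE; apply/sliceP/eqP => [H|-> //].
    by apply: word_ext => j; apply: H; rewrite (card0_eq X0 j).
  rewrite X0 invr0 mulr0 mul0r /Ent SE cards1 !big_set1 divr1 subrr //.
have Xp : 0 < #|X|%:R :> R by rewrite ltr0n.
set C := slice X w; set F := fun u => g u ^+ 2.
set D := fun u => \sum_(x in X) \sum_(y in X) sqdiff g u x y.
have D0 u : 0 <= D u by do 2!apply: sumr_ge0 => ? _; exact: sqr_ge0.
set K := (13 + 8 * \sum_i (harm R #|X| - harm R (mult X w i))) / (2 * #|X|%:R).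
have IHj j i : j \in X -> Ent (letter X w j i) F <=
    \sum_(u in letter X w j i) pot (X :\ j) u / (#|X|%:R - 1)
      * \sum_(x in X :\ j) \sum_(y in X :\ j) sqdiff g u x y.
  move=> jX.
  have [->|[v vL]] := set_0Vmem (letter X w j i).
    by rewrite /Ent !big_set0 mul0r subrr.
  move: (vL); rewrite in_letter => /andP[vS /eqP vj].
  have SE : letter X w j i = slice (X :\ j) v by rewrite (slice_setD1 vS jX) vj.
  have cX : #|X :\ j|%:R = #|X|%:R - 1 :> R.
    by rewrite [in RHS](cardsD1 j X) jX natrD [RHS]addrC addKr.
  rewrite SE; apply: le_trans (IH (X :\ j) v _) _.
    by apply: leq_trans Xm; rewrite (cardsD1 j X) jX.
  rewrite mulr_sumr -cX; apply: ler_sum => u uS.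
  by rewrite (pot_slice uS).
(* The chain rule for the letter at [j], summed over [j]: induction inside the letter classes,
   [site_logSobolev] between them. *)
have step : #|X|%:R * Ent C F <=
   \sum_(u in C) (#|X|%:R - 1)^-1 *
     (\sum_(j in X) pot (X :\ j) u *
       \sum_(x in X :\ j) \sum_(y in X :\ j) sqdiff g u x y)
   + K * \sum_(u in C) D u.
  have -> : #|X|%:R * Ent C F = \sum_(j in X) Ent C F by rewrite sumr_const mulr_natl.
  have -> : \sum_(u in C) (#|X|%:R - 1)^-1 *
     (\sum_(j in X) pot (X :\ j) u *
       \sum_(x in X :\ j) \sum_(y in X :\ j) sqdiff g u x y) =
     \sum_(j in X) \sum_(u in C) pot (X :\ j) u / (#|X|%:R - 1)
      * \sum_(x in X :\ j) \sum_(y in X :\ j) sqdiff g u x y.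
    rewrite exchange_big /=; apply: eq_bigr => u _; rewrite mulr_sumr.
    by apply: eq_bigr => j _; rewrite mulrA [_^-1 * _]mulrC.
  have -> : \sum_(u in C) D u = \sum_(j in X) \sum_(u in C) \sum_(y in X) sqdiff g u j y.
    by rewrite /D exchange_big.
  rewrite mulr_sumr -big_split /=; apply: ler_sum => j jX.
  rewrite (Ent_partition C (fun u => u j)); apply: lerD; last exact: site_logSobolev.
  rewrite [X in _ <= X](partition_big (fun u => u j) xpredT) //=.
  apply: ler_sum => i _; apply: le_trans (IHj j i jX) _.
  rewrite le_eqVlt; apply/orP; left; apply/eqP/eq_bigl => u.
  by rewrite in_letter.
rewrite -(ler_pM2l Xp); apply: le_trans step _.
have -> : #|X|%:R * (pot X w / #|X|%:R * \sum_(u in C) D u) =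
    pot X w * \sum_(u in C) D u by field; rewrite gt_eqF.
rewrite !mulr_sumr -big_split; apply: ler_sum => u uS /=.
(* For a single free coordinate the divisor [#|X| - 1] is 0, but no nontrivial swap exists and
   [D u = 0]. *)
have [X1|X1] := leqP #|X| 1.
  have D1 : D u = 0.
    have [x Xx] : exists x, X = [set x] by apply/cards1P; rewrite eqn_leq X1.
    by rewrite /D Xx !big_set1 /sqdiff swapxx subrr expr0n.
  have -> : #|X|%:R - 1 = 0 :> R.
    by apply/eqP; rewrite subr_eq0 (eqr_nat R _ 1) eqn_leq X1.
  by rewrite D1 invr0 !mulr0 mul0r addr0.
have m1 : 1 <= #|X|%:R - 1 :> R.
  by rewrite lerBrDr (_ : 1 + 1 = 2%:R) // ler_nat.
have mp : 0 < #|X|%:R - 1 :> R by lra.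
have := sum_sqdiff_setD1_le X u g; rewrite -/(D u) (pot_slice uS) => H.
apply: le_trans (_ : (#|X|%:R - 1)^-1 * (((#|X|%:R - 2) * pot X w
    + 8 * l%:R / #|X|%:R) * D u) + K * D u <= _).
  by rewrite lerD2r ler_pM2l ?invr_gt0.
rewrite mulrA -mulrDl ler_wpM2r // /K potE.
have : 1 <= l%:R :> R.
  rewrite ler1n; case/card_gt0P: X0 => j _.
  by case: (w j) => i; case: (l).
have : 0 <= \sum_i (harm R #|X| - harm R (mult X w i)).
  by apply: sumr_ge0 => i _; rewrite subr_ge0 harm_le // mult_le.
move: (\sum_i _) mp m1 Xp; move: (#|X|%:R) (l%:R) => N L S mp m1 Xp S0 L1.
(* Removing a coordinate saves [pot / (N - 1)]. The part [4 S] of [pot] absorbs [8 S / (2 N)], and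
   [12 L] with [L >= 1] absorbs [8 L] and 13. *)
rewrite -subr_ge0.
have -> : 12 * L + 4 * S - ((N - 1)^-1 * ((N - 2) * (12 * L + 4 * S) + 8 * L / N)
     + (13 + 8 * S) / (2 * N)) =
   ((12 * L + 4 * S) * N - 8 * L - (13 + 8 * S) * (N - 1) / 2) / (N * (N - 1)).
  by field; rewrite !gt_eqF.
rewrite divr_ge0 ?mulr_ge0 //; try lra.
by nra.
Qed.

End MultisliceLogSobolev.

(** * Influences on the multislice *)

(** At most two ordered pairs, [(a, b)] and [(b, a)], give the same transposition. *)
Lemma sum_tperm_le (R : realType) (n : nat) (G : 'S_n -> R) : (forall t, 0 <= G t) ->
  \sum_(p : 'I_n * 'I_n | p.1 != p.2) G (tperm p.1 p.2)
    <= 2 * \sum_(t in transpositions n) G t.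
Proof.
move=> G0; rewrite (partition_big (fun p => tperm p.1 p.2)
  (mem (transpositions n))) /= => [|[x y] /= xy]; last first.
  by rewrite inE; apply/existsP; exists x; apply/existsP; exists y; rewrite xy eqxx.
rewrite mulr_sumr; apply: ler_sum => t; rewrite inE.
case/existsP=> a /existsP[b /andP[ab /eqP tE]].
rewrite (eq_bigr (fun=> G t)) => [|p /andP[_ /eqP -> //]].
rewrite sumr_const -[X in X <= _]mulr_natl ler_wpM2r // ler_nat.
apply: leq_trans (_ : #|[set (a, b); (b, a)]| <= 2)%N; last by rewrite cards2; case: eqP.
apply/subset_leq_card/subsetP => -[x y]; rewrite !inE /= => /andP[xy /eqP xyE].
have ty : t x = y by rewrite -xyE tpermL.
move: ty xy; rewrite tE; case: tpermP => [-> ->|-> ->|_ _ ->].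
- by rewrite eqxx.
- by rewrite eqxx orbT.
- by rewrite eqxx.
Qed.

Section Multislice.
Variables (R : realType) (l n : nat) (kappa : 'I_l -> nat).
Local Notation V := (multislice n kappa).

(** Labels are all ordered pairs, so that sums over labels are double sums over coordinates;
    diagonal pairs act trivially. *)
Definition pair_swap (t : 'I_n * 'I_n) (u : V) : V := swap u t.1 t.2.

Definition pair_conj (t r : 'I_n * 'I_n) : 'I_n * 'I_n :=
  (tperm t.1 t.2 r.1, tperm t.1 t.2 r.2).

Lemma pair_conjI t : injective (pair_conj t).
Proof. by move=> [a b] [c d] [/perm_inj -> /perm_inj ->]. Qed.

Lemma pair_swap_conj t r u :
  pair_swap t (pair_swap r u) = pair_swap (pair_conj t r) (pair_swap t u).
Proof.
apply: word_ext => j; rewrite !swapE /pair_conj /=; congr (word _ _).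
by rewrite (inj_tperm _ _ _ (@perm_inj _ (tperm t.1 t.2))) !tpermK.
Qed.

Lemma half_le_ln_inv (p : R) : 0 < p -> p <= 2^-1 -> 2^-1 <= ln (1 / p).
Proof.
move=> p0 p2; have := ln_inv_ge (divr_gt0 ltr01 p0); rewrite div1r invrK.
by move=> ?; lra.
Qed.

(** Per letter, [28 = 24 + 4]: [12 <= 24 ln (1 / p)] since [ln (1 / p) >= 1/2], and the harmonic
    difference is at most [ln (1 / p)]. *)
Lemma pot_setT_le (p : R) (u : V) : (0 < n)%N -> 0 < p -> p <= 2^-1 ->
  (forall i, 0 < kappa i)%N -> (forall i, p * n%:R <= (kappa i)%:R) ->
  pot R setT u <= 28 * l%:R * ln (1 / p).
Proof.
move=> n0 p0 p2 k0 pk.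
have -> : 28 * l%:R * ln (1 / p) = \sum_(i < l) 28 * ln (1 / p).
  by rewrite sumr_const card_ord -[RHS]mulr_natl; ring.
apply: ler_sum => i _; rewrite cardsT card_ord.
have -> : mult setT u i = kappa i.
  have /forallP/(_ i)/eqP <- := wordP u.
  by apply: eq_card => j; rewrite !inE.
have kn : (kappa i <= n)%N.
  have /forallP/(_ i)/eqP <- := wordP u.
  by rewrite -[X in (_ <= X)%N]card_ord max_card.
have kp : 0 < (kappa i)%:R :> R by rewrite ltr0n.
have := harm_sub_le_ln R (k0 i) kn.
have : ln (n%:R / (kappa i)%:R) <= ln (1 / p).
  rewrite ler_ln ?posrE ?divr_gt0 ?ltr0n //.
  by rewrite ler_pdivrMr // mulrAC ler_pdivlMr // mul1r mulrC.
have := half_le_ln_inv p0 p2.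
by move=> ? ? ?; lra.
Qed.

Lemma multislice_logSobolev_dirichlet (p : R) (u0 : V) (g : V -> R) :
  (0 < n)%N -> 0 < p -> p <= 2^-1 ->
  (forall i, 0 < kappa i)%N -> (forall i, p * n%:R <= (kappa i)%:R) ->
  Ent [set: V] (fun u => g u ^+ 2)
    <= 56 * n%:R * l%:R * ln (1 / p) * dirichlet pair_swap g.
Proof.
move=> n0 p0 p2 k0 pk.
have np : 0 < n%:R :> R by rewrite ltr0n.
have T0 : (0 < #|{: 'I_n * 'I_n}|)%N by rewrite card_prod card_ord muln_gt0 n0.
have sK t : involutive (pair_swap t) by move=> u; exact: swapK.
have := multislice_logSobolev setT u0 g.
have -> : slice setT u0 = setT.
  by apply/setP => u; rewrite [RHS]inE; apply/sliceP => j; rewrite inE.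
(* The factor 2 here turns 28 into 56, and dividing [n^2] by [#|X| = n] leaves one [n]. *)
have -> : \sum_(u in [set: V]) \sum_(x in [set: 'I_n]) \sum_(y in [set: 'I_n])
    sqdiff g u x y = 2 * n%:R ^+ 2 * dirichlet pair_swap g.
  have := sum_sum_deriv_sqr sK T0 g; rewrite card_prod card_ord natrM -expr2 => <-.
  rewrite [RHS]exchange_big /=; apply: eq_big => [u|u _]; first by rewrite inE.
  rewrite -(pair_bigA _ (fun x y => deriv pair_swap (x, y) g u ^+ 2)) /=.
  apply: eq_big => [x|x _]; first by rewrite inE.
  by apply: eq_big => [y|y _]; first by rewrite inE.
rewrite cardsT card_ord => /le_trans; apply.
have D0 : 0 <= dirichlet pair_swap g by exact: dirichlet_ge0.
have H := pot_setT_le u0 n0 p0 p2 k0 pk.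
have -> : pot R setT u0 / n%:R * (2 * n%:R ^+ 2 * dirichlet pair_swap g) =
   pot R setT u0 * (2 * n%:R * dirichlet pair_swap g).
  by field; rewrite gt_eqF.
apply: le_trans (ler_wpM2r _ H) _; first by rewrite !mulr_ge0.
by rewrite le_eqVlt; apply/orP; left; apply/eqP; ring.
Qed.

Lemma influence_ge0 t (f : V -> R) : 0 <= influence t f.
Proof.
rewrite /influence mulr_ge0 ?invr_ge0 // divr_ge0 // sumr_ge0 // => u _.
exact: sqr_ge0.
Qed.

Lemma sum_deriv_influence t (f : V -> R) : (0 < #|{: V}|)%N ->
  \sum_u deriv pair_swap t f u ^+ 2 =
  2 * #|{: V}|%:R * influence (tperm t.1 t.2) f.
Proof.
move=> N0; rewrite /influence /expectation -/(deriv _ _ _).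
by field; rewrite pnatr_eq0 -lt0n.
Qed.

Lemma influence_tpermxx x (f : V -> R) : influence (tperm x x) f = 0.
Proof.
rewrite /influence /expectation big1 ?mul0r ?mulr0 // => u _.
by rewrite -[Defs.act _ _]/(swap u x x) swapxx subrr expr0n.
Qed.

(** Among the [n^2] labels a transposition occurs at most twice, the diagonal contributes nothing,
    and [2 * 'C(n, 2) <= n^2]. *)
Lemma dirichlet_le_energy (f : V -> R) : (1 < n)%N -> (0 < #|{: V}|)%N ->
  dirichlet pair_swap f <= #|{: V}|%:R * energy f.
Proof.
move=> n1 N0; have n0 : (0 < n)%N by exact: ltnW.
have T0 : (0 < #|{: 'I_n * 'I_n}|)%N by rewrite card_prod card_ord muln_gt0 n0.
have sK t : involutive (pair_swap t) by move=> u; exact: swapK.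
have := sum_sum_deriv_sqr sK T0 f; rewrite card_prod card_ord natrM -expr2.
under eq_bigr => t _ do rewrite sum_deriv_influence //.
rewrite -mulr_sumr (bigID (fun t => t.1 != t.2)) /=.
rewrite [X in _ * (_ + X)]big1 ?addr0 => [E|[x y]]; last first.
  by rewrite negbK /= => /eqP ->; exact: influence_tpermxx.
have nR : 0 < n%:R :> R by rewrite ltr0n.
have NR : 0 < #|{: V}|%:R :> R by rewrite ltr0n.
have C0 : 0 < 'C(n, 2)%:R :> R by rewrite ltr0n bin_gt0.
have C2 : 2 * 'C(n, 2)%:R <= n%:R ^+ 2 :> R.
  rewrite -natrM -natrX ler_nat mulnC -[2%N]/(2`!) bin_ffact ffactnS ffactn1.
  by rewrite expnS expn1 leq_mul2l leq_pred orbT.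
have := sum_tperm_le (fun t => influence_ge0 t f).
have -> : \sum_(t in transpositions n) influence t f = 'C(n, 2)%:R * energy f.
  by rewrite /energy mulVKf // gt_eqF.
set S := \sum_(p | _) _ in E * => HS.
have E0 : 0 <= energy f.
  rewrite /energy mulr_ge0 ?invr_ge0 // sumr_ge0 // => t _; exact: influence_ge0.
have n2 : 0 < 2 * n%:R ^+ 2 :> R by rewrite mulr_gt0 // exprn_gt0.
rewrite -(ler_pM2l n2) -E mulrCA mulrA.
apply: le_trans (ler_wpM2l _ HS) _; first by rewrite mulr_ge0.
have := ler_wpM2l (mulr_ge0 (ltW NR) E0) C2.
by move=> ?; lra.
Qed.

(** * Application to indicator functions *)

Lemma influence_indicator_le t (A : {set V}) : influence t (indicator R A) <= 2^-1.
Proof.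
rewrite /influence ler_piMr ?invr_ge0 // /expectation.
have [->|N0] := posnP #|{: V}|; first by rewrite invr0 mulr0.
rewrite ler_pdivrMr ?ltr0n // mul1r -sum1_card natr_sum; apply: ler_sum => u _.
rewrite /indicator; case: (_ \in _); case: (_ \in _);
  by rewrite ?(subrr, subr0, sub0r, sqrrN, expr0n, expr1n).
Qed.

Lemma one_lt_length : (1 < l)%N -> (forall i, 0 < kappa i)%N ->
  (\sum_i kappa i)%N = n -> (1 < n)%N.
Proof.
move=> l1 k0 kn; apply: leq_trans l1 _.
by rewrite -kn -[X in (X <= _)%N]card_ord -sum1_card; exact: leq_sum.
Qed.

Lemma ratio_le_half (p : R) : (1 < l)%N -> (0 < n)%N -> (\sum_i kappa i)%N = n ->
  0 < p -> (forall i, p * n%:R <= (kappa i)%:R) -> p <= 2^-1.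
Proof.
move=> l1 n0 kn p0 pk.
have : l%:R * (p * n%:R) <= n%:R.
  rewrite -[X in _ <= X%:R]kn natr_sum.
  have -> : l%:R * (p * n%:R) = \sum_(i < l) p * n%:R.
    by rewrite sumr_const card_ord mulr_natl.
  by apply: ler_sum => i _.
have lR : 2 <= l%:R :> R by rewrite ler_nat.
rewrite mulrA ger_pMl ?ltr0n // => lp.
have : 2 * p <= l%:R * p by rewrite ler_pM2r.
by move=> ?; lra.
Qed.

(** The constant is [1344 = 2 * 12 * 56]: 56 from log-Sobolev, 12 from [4 (K + m) <= 12 K], and 2
    from [vol (1 - vol) >= eps / 2]. *)
Lemma energy_indicator_ge (A : {set V}) (p eps : R) :
  (1 < l)%N -> (forall i, 0 < kappa i)%N -> (\sum_i kappa i)%N = n ->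
  0 < p -> 0 < eps -> (forall i, p * n%:R <= (kappa i)%:R) ->
  eps <= vol R A <= 1 - eps ->
  0 < max_influence (indicator R A) ->
  ln (1 / max_influence (indicator R A)) * eps
    <= 1344 * (n%:R * l%:R * ln (1 / p)) * energy (indicator R A).
Proof.
move=> l1 k0 kn p0 e0 pk /andP[ev v1]; set M := max_influence _ => M0.
set f := indicator R A.
have n1 : (1 < n)%N by exact: one_lt_length kn.
have n0 : (0 < n)%N by exact: ltnW.
have nR : 1 <= n%:R :> R by rewrite ler1n.
have p2 : p <= 2^-1 by exact: ratio_le_half kn p0 pk.
have lam := half_le_ln_inv p0 p2.
have N0 : (0 < #|{: V}|)%N.
  rewrite lt0n; apply: contraTneq e0 => N0.
  by rewrite -leNgt; apply: le_trans ev _; rewrite /vol N0 invr0 mulr0.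
have NR : 0 < #|{: V}|%:R :> R by rewrite ltr0n.
have [u0 _] := card_gt0P N0.
have T0 : (0 < #|{: 'I_n * 'I_n}|)%N by rewrite card_prod card_ord muln_gt0 n0.
have sK t : involutive (pair_swap t) by move=> u; exact: swapK.
pose K := 56 * n%:R * l%:R * ln (1 / p).
have K1 : 1 <= K.
  have nl : 1 <= n%:R * l%:R :> R.
    by rewrite -natrM ler1n muln_gt0 n0 ltnW.
  rewrite /K -mulrA -mulrA [n%:R * _]mulrA.
  have : 2^-1 <= n%:R * l%:R * ln (1 / p) by rewrite -[X in X <= _]mul1r ler_pM ?invr_ge0.
  by move=> ?; lra.
(* A walk of integer length between [K] and [2 K]. *)
pose m := (Num.truncn K).+1.
have mK : K <= m%:R by exact/ltW/truncnS_gt.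
have mK2 : m%:R <= 2 * K.
  have : (Num.truncn K)%:R <= K by rewrite truncn_le; lra.
  by rewrite /m -natr1; lra.
have M2 : M <= 2^-1.
  by apply: bigmax_le => [|t _]; rewrite ?invr_ge0 ?influence_indicator_le.
have inflM (t : 'I_n * 'I_n) : \sum_u deriv pair_swap t f u ^+ 2 <= 2 * M * #|{: V}|%:R.
  rewrite sum_deriv_influence // mulrAC ler_pM2r //.
  rewrite ler_pM2l //; have [xy|xy] := eqVneq t.1 t.2.
    by rewrite xy influence_tpermxx ltW.
  apply: le_bigmax_cond.
  by rewrite inE; apply/existsP; exists t.1; apply/existsP; exists t.2; rewrite xy eqxx.
have f01 u : (f u == 0) || (f u == 1).
  by rewrite /f /indicator; case: (_ \in _); rewrite eqxx ?orbT.
have := talagrand_Schreier sK pair_conjI pair_swap_conj T0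
  (fun g => multislice_logSobolev_dirichlet u0 g n0 p0 p2 k0 pk) M0 M2 f01 inflM K1 mK.
have sumf : \sum_u f u = #|A|%:R.
  rewrite /f /indicator -sum1_card natr_sum [RHS]big_mkcond /=.
  by apply: eq_bigr => u _; case: (_ \in _).
have sumf2 : \sum_u f u ^+ 2 = #|A|%:R.
  rewrite -sumf; apply: eq_bigr => u _.
  by case/orP: (f01 u) => /eqP ->; rewrite ?expr0n ?expr1n.
rewrite sumf sumf2.
have -> : #|A|%:R - #|A|%:R ^+ 2 / #|{: V}|%:R
    = #|{: V}|%:R * (vol R A * (1 - vol R A)) :> R.
  by rewrite /vol; field; rewrite gt_eqF.
have vol_ge : eps / 2 <= vol R A * (1 - vol R A) by nra.
have L0 : 0 <= ln (1 / M).
  by apply: ln_ge0; rewrite ler_pdivlMr // mul1r; lra.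
have DE := dirichlet_le_energy f n1 N0.
have D0 : 0 <= dirichlet pair_swap f by exact: dirichlet_ge0.
move=> H.
have H1 : 4 * (K + m%:R) * dirichlet pair_swap f
    <= 12 * K * (#|{: V}|%:R * energy f).
  by apply: ler_pM => //; lra.
have H2 : ln (1 / M) * (#|{: V}|%:R * (eps / 2)) <=
    12 * K * (#|{: V}|%:R * energy f).
  apply: le_trans H1; apply: le_trans H.
  by rewrite ler_wpM2l // ler_pM2l.
rewrite -(ler_pM2l (divr_gt0 NR (ltr0n R 2))).
have -> : #|{: V}|%:R / 2 * (ln (1 / M) * eps) =
  ln (1 / M) * (#|{: V}|%:R * (eps / 2)) by field.
by apply: le_trans H2 _; rewrite /K le_eqVlt; apply/orP; left; apply/eqP; field.
Qed.

End Multislice.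

Theorem corollary4p2 (R : realType) :
  exists2 c : R, 0 < c &
  forall (l n : nat) (kappa : 'I_l -> nat) (A : {set multislice n kappa})
         (p eps : R),
    (2 <= l)%N ->
    (forall i : 'I_l, (0 < kappa i)%N) ->
    (\sum_(i < l) kappa i)%N = n ->
    0 < p ->
    0 < eps ->
    (forall i : 'I_l, p * n%:R <= (kappa i)%:R) ->
    eps <= vol R A <= 1 - eps ->
    c * (eps / (l%:R * ln (1 / p)))
      * (ln (1 / max_influence (indicator R A)) / n%:R)
    <= energy (indicator R A).
Proof.
exists (1344^-1) => [|l n kappa A p eps l1 k0 kn p0 e0 pk v]; first by rewrite invr_gt0.
have E0 : 0 <= energy (indicator R A).
  by rewrite /energy mulr_ge0 ?invr_ge0 // sumr_ge0 // => t _; exact: influence_ge0.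
(* When no influence is positive, [ln (1 / M)] takes its default value 0 and the claim is
   nonnegativity of the energy. *)
have [M0|M0] := leP (max_influence (indicator R A)) 0.
  by rewrite (@ln0 _ (1 / max_influence _)) ?mul0r ?mulr0 // div1r invr_le0.
have := energy_indicator_ge l1 k0 kn p0 e0 pk v M0.
set L := ln (1 / max_influence _); set E := energy _ in E0 * => H.
set P := n%:R * l%:R * ln (1 / p) in H.
have -> : 1344^-1 * (eps / (l%:R * ln (1 / p))) * (L / n%:R) = L * eps / (1344 * P).
  by rewrite /P -!mulrA !invfM; ring.
have n1 := one_lt_length l1 k0 kn.
have p2 := ratio_le_half l1 (ltnW n1) kn p0 pk.
have P0 : 0 < P.
  rewrite !mulr_gt0 ?ltr0n //; [exact: ltnW|exact: ltnW|].
  by have := half_le_ln_inv p0 p2; lra.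
by rewrite ler_pdivrMr ?[E * _]mulrC // mulr_gt0 // ltr0n.
Qed.
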